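(* A modified Patankar-Runge-Kutta (MPRK) scheme applied to a conservative production-destruction system is unconditionally conservative, i.e. for all $\Delta t>0$ and all $\mathbf y^n>0$, $$\sum_{i=1}^N\bigl(y_i^{n+1}-y_i^n\bigr)=0 .$$ If $\delta=1$, the same holds for all stage values, i.e. $\sum_{i=1}^N\bigl(y_i^{(k)}-y_i^n\bigr)=0$ for $k=1,\dots,s$.
   Context: A production-destruction system (PDS) is an ODE system $y_i'(t)=P_i(\mathbf y(t))-D_i(\mathbf y(t))$, $i=1,\dots,N$, with $P_i(\mathbf y)=\sum_{j=1}^N p_{ij}(\mathbf y)$, $D_i(\mathbf y)=\sum_{j=1}^N d_{ij}(\mathbf y)$, $p_{ij},d_{ij}\ge0$. It is conservative if $p_{ij}(\mathbf y)=d_{ji}(\mathbf y)$ for all $i,j$ and all $\mathbf y\ge0$ (componentwise). Given a non-negative Runge-Kutta matrix $(a_{k\nu})_{k,\nu=1,\dots,s}$, non-negative weights $b_1,\dots,b_s$ and $\delta\in\{0,1\}$, an MPRK scheme is the one-step scheme $\mathbf y^n\mapsto\mathbf y^{n+1}$ given for $i=1,\dots,N$ by $$y_i^{(k)}=y_i^n+\Delta t\sum_{\nu=1}^{k-1}a_{k\nu}\sum_{j=1}^N\Bigl(p_{ij}(\mathbf y^{(\nu)})(1-\delta)+p_{ij}(\mathbf y^{(\nu)})\frac{y_j^{(k)}}{\pi_j^{(k)}}\delta-d_{ij}(\mathbf y^{(\nu)})\frac{y_i^{(k)}}{\pi_i^{(k)}}\Bigr),\quad k=1,\dots,s,$$ $$y_i^{n+1}=y_i^n+\Delta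 t\sum_{k=1}^s b_k\sum_{j=1}^N\Bigl(p_{ij}(\mathbf y^{(k)})\frac{y_j^{n+1}}{\sigma_j}-d_{ij}(\mathbf y^{(k)})\frac{y_i^{n+1}}{\sigma_i}\Bigr),$$ where the Patankar-weight denominators $\pi_i^{(k)}$ and $\sigma_i$ are positive for all $\Delta t>0$ and $\mathbf y^n>0$, $\pi_i^{(k)}$ is independent of $y_i^{(k)}$, and $\sigma_i$ is independent of $y_i^{n+1}$ (they may depend on $\Delta t$, $\mathbf y^n$ and previously computed stage values). *)

(* Defs.v *)
From mathcomp Require Import all_boot all_order all_algebra.
From mathcomp Require Import reals.

Set Implicit Arguments.
Unset Strict Implicit.
Unset Printing Implicit Defensive.

Import Order.TTheory GRing.Theory Num.Theory.
Local Open Scope ring_scope.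

Definition pos_vec (R : realType) (N : nat) (y : 'rV[R]_N) : Prop :=
  forall i, 0 < y 0 i.

Definition nneg_vec (R : realType) (N : nat) (y : 'rV[R]_N) : Prop :=
  forall i, 0 <= y 0 i.

(* The system y_i' = \sum_j prod_rate i j y - \sum_j dest_rate i j y.
   The rates are total functions, constrained only on nonnegative states. *)
Record pds (R : realType) (N : nat) := PDS {
  prod_rate : 'I_N -> 'I_N -> 'rV[R]_N -> R;
  dest_rate : 'I_N -> 'I_N -> 'rV[R]_N -> R;
  prod_rate_ge0 : forall i j y, nneg_vec y -> 0 <= prod_rate i j y;
  dest_rate_ge0 : forall i j y, nneg_vec y -> 0 <= dest_rate i j y
}.

Definition conservative (R : realType) (N : nat) (S : pds R N) : Prop :=
  forall i j y, nneg_vec y -> prod_rate S i j y = dest_rate S j i y.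

(* The denominators are functions of the step size, of y^n and of the stage
   values already computed: those of index < k for [pi_den k], all s of them
   for [sigma_den]. *)
Record mprk (R : realType) (N s : nat) := MPRK {
  rkA : 'M[R]_s;
  rkb : 'rV[R]_s;
  delta : bool;
  pi_den : forall k : 'I_s, R -> 'rV[R]_N -> ('I_k -> 'rV[R]_N) -> 'rV[R]_N;
  sigma_den : R -> 'rV[R]_N -> ('I_s -> 'rV[R]_N) -> 'rV[R]_N;
  rkA_ge0 : forall k nu, 0 <= rkA k nu;
  rkb_ge0 : forall k, 0 <= rkb 0 k
}.

Definition prev_stages (R : realType) (N s : nat) (Y : 'I_s -> 'rV[R]_N)
    (k : 'I_s) : 'I_k -> 'rV[R]_N :=
  fun nu => Y (widen_ord (ltnW (ltn_ord k)) nu).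

Definition pi_at (R : realType) (N s : nat) (M : mprk R N s) (dt : R)
    (yn : 'rV[R]_N) (Y : 'I_s -> 'rV[R]_N) (k : 'I_s) : 'rV[R]_N :=
  @pi_den R N s M k dt yn (@prev_stages R N s Y k).

(* The stage and update formulas are implicit, so they are relations. *)
Definition mprk_stages (R : realType) (N s : nat) (M : mprk R N s)
    (S : pds R N) (dt : R) (yn : 'rV[R]_N) (Y : 'I_s -> 'rV[R]_N) : Prop :=
  forall (k : 'I_s) (i : 'I_N),
    Y k 0 i = yn 0 i + dt * \sum_(nu < s | (nu < k)%N) rkA M k nu *
      \sum_(j < N)
        (prod_rate S i j (Y nu) * (1 - (delta M)%:R)
         + prod_rate S i j (Y nu) * (Y k 0 j / pi_at M dt yn Y k 0 j)
             * (delta M)%:R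
         - dest_rate S i j (Y nu) * (Y k 0 i / pi_at M dt yn Y k 0 i)).

Definition mprk_update (R : realType) (N s : nat) (M : mprk R N s)
    (S : pds R N) (dt : R) (yn : 'rV[R]_N) (Y : 'I_s -> 'rV[R]_N)
    (y1 : 'rV[R]_N) : Prop :=
  forall i : 'I_N,
    y1 0 i = yn 0 i + dt * \sum_(k < s) rkb M 0 k *
      \sum_(j < N)
        (prod_rate S i j (Y k) * (y1 0 j / sigma_den M dt yn Y 0 j)
         - dest_rate S i j (Y k) * (y1 0 i / sigma_den M dt yn Y 0 i)).

(* Positivity of the denominators for all dt > 0 and y^n > 0, required only
   along the stage values that the scheme produces from (dt, y^n), not for
   arbitrary values of the stage arguments. *)
Definition pos_denominators (R : realType) (N s : nat) (M : mprk R N s)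
    (S : pds R N) : Prop :=
  forall (dt : R) (yn : 'rV[R]_N) (Y : 'I_s -> 'rV[R]_N),
    0 < dt -> pos_vec yn -> mprk_stages M S dt yn Y ->
    (forall k, pos_vec (pi_at M dt yn Y k)) /\
    pos_vec (sigma_den M dt yn Y).

(* Main.v *)
Require Import Defs.
From mathcomp Require Import all_boot all_order all_algebra.
From mathcomp Require Import reals.

Set Implicit Arguments.
Unset Strict Implicit.
Unset Printing Implicit Defensive.

Import Order.TTheory GRing.Theory Num.Theory.
Local Open Scope ring_scope.

(** In the update, and in the stages when [delta = 1], the production [p i j] and
    the destruction [d j i] carry the same Patankar weight, that of the donor
    [j].  What component [i] receives from [j] is therefore exactly what [j]
    loses to [i], and the sum over all components is an antisymmetric double
    sum, which vanishes ([sum_exchange_eq0]).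

    The identity [p i j = d j i] is available at nonnegative states only, so the
    stage values must first be shown nonnegative ([stage_ge0]).  This goes by
    strong induction on the stage index: stage [k] uses the rates at earlier
    stages, where the identity already holds, and it is a linear system for
    [Y k].  For [delta = 0] it is diagonal with positive entries and nonnegative
    data.  For [delta = 1] its matrix is an M-matrix with unit column sums; the
    nonnegativity of its solution is proved without inverting it, by a mass
    balance on the set of components where the solution is negative
    ([patankar_solution_ge0]). *)

(** Restricted to any set of components, the internal exchanges cancel; the
    restriction is what allows a mass balance on a subset. *)
Lemma sum_exchange_eq0 (V : zmodType) (T : finType) (P : pred T)
    (f : T -> T -> V) :
  \sum_(i | P i) \sum_(j | P j) (f j i - f i j) = 0.
Proof.
under eq_bigr do rewrite sumrB.
by rewrite sumrB exchange_big subrr.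
Qed.

(** Consider the set of components where [y] is negative.  Exchanges inside it
    cancel, and exchanges with the outside can only bring mass in: a donor inside
    has a negative weight, a donor outside a nonnegative one.  So the total of
    [y] over the set is at least that of [x], hence nonnegative, and the set
    must be empty. *)
Lemma patankar_solution_ge0 (R : realFieldType) (T : finType)
    (c : T -> T -> R) (x y w : T -> R) :
  (forall i j, 0 <= c i j) -> (forall i, 0 <= x i) -> (forall i, 0 < w i) ->
  (forall i, y i = x i +
     \sum_j (c j i * (y j / w j) - c i j * (y i / w i))) ->
  forall i, 0 <= y i.
Proof.
move=> c_ge0 x_ge0 w_gt0 yE i; rewrite leNgt; apply/negP => yi_lt0.
pose neg := [pred j | y j < 0].
have neg_sum_ge0 : 0 <= \sum_(j | neg j) y j.
  under eq_bigr => j _ do rewrite yE (bigID neg) /=.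
  rewrite !big_split /=.
  rewrite (sum_exchange_eq0 neg (fun j k => c j k * (y j / w j))) add0r.
  apply: addr_ge0; first exact: sumr_ge0.
  apply: sumr_ge0 => j yj_lt0; apply: sumr_ge0 => k; rewrite -leNgt => yk_ge0.
  rewrite subr_ge0; apply: (@le_trans _ _ 0).
    by rewrite mulr_ge0_le0 // pmulr_lle0 ?invr_gt0 // ltW.
  by rewrite mulr_ge0 // divr_ge0 // ltW.
have: \sum_(j | neg j) y j < 0.
  rewrite (bigD1 i) //=; apply: ltr_wnDr => //.
  by apply: sumr_le0 => j /andP[/ltW].
by rewrite ltNge neg_sum_ge0.
Qed.

(** This absorbs the Runge-Kutta coefficients: since all the terms share their
    Patankar weights, the whole increment is a single exchange.  The conservation
    identity is asked only for the indices selected by [Q], so that a stage calls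
    for it at earlier stages only; the weights [u] of production and [z] of
    destruction are kept apart because they differ when [delta = 0]. *)
Lemma combined_exchange (R : comPzRingType) (T I : finType) (Q : pred I)
    (dt : R) (a : I -> R) (p d : T -> T -> I -> R) (u z : T -> R) (i : T) :
  (forall m j k, Q m -> p j k m = d k j m) ->
  let c j k := dt * \sum_(m | Q m) a m * d j k m in
  dt * \sum_(m | Q m) a m * \sum_j (p i j m * u j - d i j m * z i) =
  \sum_j (c j i * u j - c i j * z i).
Proof.
move=> pd /=.
under [in RHS]eq_bigr do rewrite -!mulrA !mulr_suml -mulrBr -sumrB.
rewrite -mulr_sumr exchange_big /=; congr (_ * _).
apply: eq_bigr => m Qm; rewrite mulr_sumr; apply: eq_bigr => j _.
by rewrite pd // mulrBr !mulrA.
Qed.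

(** The amount that component [i] gives to component [j] in stage [k], per unit of
    Patankar weight. *)
Definition stage_coef (R : realType) (N s : nat) (M : mprk R N s)
    (S : pds R N) (dt : R) (Y : 'I_s -> 'rV[R]_N) (k : 'I_s) (i j : 'I_N) : R :=
  dt * \sum_(nu < s | (nu < k)%N) rkA M k nu * dest_rate S i j (Y nu).

(** The conservation identity can be used in stage [k] as soon as the earlier
    stages are nonnegative, which is what the induction on stages provides. *)
Lemma stage_exchange (R : realType) (N s : nat) (S : pds R N)
    (M : mprk R N s) (dt : R) (yn : 'rV[R]_N) (Y : 'I_s -> 'rV[R]_N)
    (k : 'I_s) (i : 'I_N) :
  conservative S -> mprk_stages M S dt yn Y ->
  (forall nu : 'I_s, (nu < k)%N -> nneg_vec (Y nu)) ->
  let c := stage_coef M S dt Y k in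
  let z j := Y k 0 j / pi_at M dt yn Y k 0 j in
  Y k 0 i = yn 0 i +
    \sum_j (c j i * (if delta M then z j else 1) - c i j * z i).
Proof.
move=> consS stagesY prev_ge0 c z; rewrite [LHS]stagesY; congr (_ + _).
have rateE (nu : 'I_s) j l : (nu < k)%N ->
    prod_rate S j l (Y nu) = dest_rate S l j (Y nu).
  by move=> /prev_ge0; apply: consS.
apply: etrans (combined_exchange dt (rkA M k)
  (fun j => if delta M then z j else 1) z i rateE).
congr (_ * _); apply: eq_bigr => nu _; congr (_ * _); apply: eq_bigr => j _.
by case: (delta M); rewrite ?subrr ?subr0 ?mulr0 ?mulr1 ?add0r ?addr0.
Qed.

(** The matrix of stage [k] involves earlier stages only, so its sign properties
    come from the induction hypothesis. *)
Lemma stage_ge0 (R : realType) (N s : nat) (S : pds R N) (M : mprk R N s)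
    (dt : R) (yn : 'rV[R]_N) (Y : 'I_s -> 'rV[R]_N) :
  conservative S -> 0 <= dt -> nneg_vec yn ->
  (forall k, pos_vec (pi_at M dt yn Y k)) -> mprk_stages M S dt yn Y ->
  forall k, nneg_vec (Y k).
Proof.
move=> consS dt_ge0 yn_ge0 pi_gt0 stagesY k.
have [n] := ubnP (k : nat); elim: n k => // n IHn k; rewrite ltnS => le_kn.
have prev_ge0 (nu : 'I_s) : (nu < k)%N -> nneg_vec (Y nu).
  by move=> lt_nuk; apply: IHn; apply: leq_trans le_kn.
have c_ge0 i j : 0 <= stage_coef M S dt Y k i j.
  apply: mulr_ge0 => //; apply: sumr_ge0 => nu /prev_ge0 Ynu_ge0.
  by rewrite mulr_ge0 ?rkA_ge0 ?dest_rate_ge0.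
have := stage_exchange _ consS stagesY prev_ge0 => /=.
case: (delta M) => YE; first exact: patankar_solution_ge0 (pi_gt0 k) YE.
(* Unweighted production is a nonnegative source, and a negative component
   would make its own destruction terms sources as well. *)
move=> i; case Yi_lt0: (Y k 0 i < 0); last by rewrite leNgt Yi_lt0.
rewrite YE addr_ge0 // sumr_ge0 // => j _.
rewrite mulr1 addr_ge0 // oppr_ge0 mulr_ge0_le0 // pmulr_lle0 ?invr_gt0 //.
  exact: ltW.
exact: pi_gt0.
Qed.

Theorem lemma2p6 (R : realType) (N s : nat) (S : pds R N) (M : mprk R N s)
    (hcons : conservative S) (hpos : pos_denominators M S) :
  (forall (dt : R) (yn : 'rV[R]_N) (Y : 'I_s -> 'rV[R]_N) (y1 : 'rV[R]_N),
      0 < dt -> pos_vec yn ->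
      mprk_stages M S dt yn Y -> mprk_update M S dt yn Y y1 ->
      \sum_(i < N) (y1 0 i - yn 0 i) = 0) /\
  (delta M ->
   forall (dt : R) (yn : 'rV[R]_N) (Y : 'I_s -> 'rV[R]_N),
      0 < dt -> pos_vec yn ->
      mprk_stages M S dt yn Y ->
      forall k : 'I_s, \sum_(i < N) (Y k 0 i - yn 0 i) = 0).
Proof.
have Y_ge0 dt yn Y : 0 < dt -> pos_vec yn -> mprk_stages M S dt yn Y ->
    forall k, nneg_vec (Y k).
  move=> dt_gt0 yn_gt0 stagesY; have [pi_gt0 _] := hpos _ _ _ dt_gt0 yn_gt0 stagesY.
  by apply: stage_ge0 stagesY => // [|i]; apply: ltW.
split=> [dt yn Y y1 dt_gt0 yn_gt0 stagesY updateY
        | deltaM dt yn Y dt_gt0 yn_gt0 stagesY k].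
- pose z j := y1 0 j / sigma_den M dt yn Y 0 j.
  have rateE (k : 'I_s) i j : xpredT k ->
      prod_rate S i j (Y k) = dest_rate S j i (Y k).
    by move=> _; apply/hcons/(Y_ge0 dt yn Y).
  rewrite -[RHS](sum_exchange_eq0 xpredT (fun i j =>
    (dt * \sum_(k < s) rkb M 0 k * dest_rate S i j (Y k)) * z i)).
  apply: eq_bigr => i _; rewrite updateY addrC addKr.
  exact: etrans (combined_exchange dt (rkb M 0) z z i rateE) _.
- pose z j := Y k 0 j / pi_at M dt yn Y k 0 j.
  rewrite -[RHS](sum_exchange_eq0 xpredT (fun i j =>
    stage_coef M S dt Y k i j * z i)).
  apply: eq_bigr => i _.
  rewrite (stage_exchange i hcons stagesY); last first.
    by move=> nu _; apply: (Y_ge0 dt yn Y).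
  by rewrite deltaM addrC addKr.
Qed.
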